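(* Let $\mathbb{F}$ be a field, $n\geq 1$ an integer, and let $A\in\mathrm{GL}_n(\mathbb{F})$ have determinant $\pm 1$. Then the matrix $A\oplus I_n\in\mathrm{GL}_{2n}(\mathbb{F})$ is the product of three involutions of $\mathrm{GL}_{2n}(\mathbb{F})$.
   Context: $A\oplus B$ denotes the block-diagonal matrix with diagonal blocks $A$ and $B$. A matrix $S\in\mathrm{GL}_m(\mathbb{F})$ is an involution if $S^2=I_m$ (so $I_m$ is an involution). *)

(* Defs.v *)
From mathcomp Require Import all_boot all_algebra.

Set Implicit Arguments.
Unset Strict Implicit.
Unset Printing Implicit Defensive.

Import GRing.Theory.
Local Open Scope ring_scope.

Definition mx_involution (F : fieldType) (m : nat) (S : 'M[F]_m) : Prop :=
  S \in unitmx /\ S *m S = 1%:M.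

(* Main.v *)
Require Import Defs.
From mathcomp Require Import all_boot all_algebra perm.

(** A matrix is a product of two involutions exactly when some involution T
    conjugates it to its inverse, and M is a product of three involutions
    exactly when S M has this property for some involution S. So an involution S
    is wanted for which S (A (+) I) can be inverted by an involution.

    The Fitting decomposition ([fitting_split]) writes A as A1 (+) A2, with A1
    unipotent and 1 not an eigenvalue of A2. The unipotent part needs no help
    from the identity block: it is already a product of two involutions
    ([unipotent_bireflectional]), because it is a direct sum of Jordan blocks and
    a Jordan block is cyclic with the same annihilating polynomial as its inverse
    ([cyclic_bireflectional]). In particular det A1 and hence det A2 is 1 or -1.

    When 1 is not an eigenvalue of A, the identity block gives complete freedom:
    for every B of the size of A, a suitable S makes S (A (+) I) similar to
    N = [B, 1; A, 0], the linearisation of t^2 - t B - A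
    ([trireflectional_of_companion]). It remains to choose B so that N is a
    product of two involutions.

    If A is not scalar, it is similar to a product L U where L is lower
    triangular with unit diagonal and U is upper triangular with diagonal
    (1, ..., 1, det A) ([nonscalar_LU]). For A = L U and B = U - L the quadratic
    polynomial t^2 - t B - A factors as (t + L) (t - U), and N is similar to
    [U, L; 0, -L]. All eigenvalues of N are then 1 or -1, so N is a direct sum of
    a unipotent matrix and the opposite of one, which settles this case.

    If A is the scalar lam, put mu = - lam. Whatever B is, N + mu N^-1 = B (+) B,
    so the equation satisfied by N is under control: there is a monic D of degree
    n with D(x + mu/x) = x^n + (mu/x)^n ([dickson_exists]), and if B is a companion
    matrix of D - (1 + eps), where eps = mu^n is 1 or -1, then
    (N^n - 1) (N^n - eps) = 0. This polynomial has degree 2n, it also annihilates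
    N^-1, and N is cyclic because B is, so N is a product of two involutions. *)

Set Implicit Arguments.
Unset Strict Implicit.
Unset Printing Implicit Defensive.

Import GRing.Theory.
Local Open Scope ring_scope.

(** * Products of two and three involutions *)

Section Involutions.
Variable F : fieldType.

(** Since A = T (T A), this says that A is a product of two involutions. *)
Definition bireflectional n (A : 'M[F]_n) : Prop :=
  exists2 T : 'M[F]_n, T *m T = 1%:M & (T *m A) *m (T *m A) = 1%:M.

Definition trireflectional n (A : 'M[F]_n) : Prop :=
  exists2 S : 'M[F]_n, S *m S = 1%:M & bireflectional (S *m A).

Definition nilpotent_mx n (Z : 'M[F]_n) : Prop := exists k, Z ^+ k = 0.

Lemma mulmx_conj m n (P : 'M[F]_(m, n)) (Q : 'M_(n, m)) (X Y : 'M_m) :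
  P *m Q = 1%:M -> (Q *m X *m P) *m (Q *m Y *m P) = Q *m (X *m Y) *m P.
Proof. by move=> PQ; rewrite !mulmxA -(mulmxA _ P) PQ mulmx1. Qed.

(** Similarity is expressed by two rectangular matrices that are inverse to each
    other. Their sizes are equal numbers, but need not be equal by computation:
    a basis adapted to a decomposition has m1 + m2 rows, and no cast is needed. *)
Lemma bireflectional_conj m n (P : 'M[F]_(m, n)) (Q : 'M_(n, m)) (B : 'M_m) :
    P *m Q = 1%:M -> Q *m P = 1%:M ->
  bireflectional B -> bireflectional (Q *m B *m P).
Proof.
move=> PQ QP [T TT TB]; exists (Q *m T *m P).
  by rewrite mulmx_conj// TT mulmx1.
by rewrite !mulmx_conj// TB mulmx1.
Qed.

Lemma trireflectional_conj m n (P : 'M[F]_(m, n)) (Q : 'M_(n, m)) (B : 'M_m) :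
    P *m Q = 1%:M -> Q *m P = 1%:M ->
  trireflectional B -> trireflectional (Q *m B *m P).
Proof.
move=> PQ QP [S SS SB]; exists (Q *m S *m P).
  by rewrite mulmx_conj// SS mulmx1.
by rewrite mulmx_conj//; apply: bireflectional_conj.
Qed.

Lemma mulmx_block_diag m n (A A' : 'M[F]_m) (B B' : 'M_n) :
  block_mx A 0 0 B *m block_mx A' 0 0 B' = block_mx (A *m A') 0 0 (B *m B').
Proof. by rewrite mulmx_block !(mulmx0, mul0mx, addr0, add0r). Qed.

Lemma bireflectional_block m n (A : 'M[F]_m) (B : 'M_n) :
  bireflectional A -> bireflectional B -> bireflectional (block_mx A 0 0 B).
Proof.
move=> [S SS SA] [T TT TB]; exists (block_mx S 0 0 T).
  by rewrite mulmx_block_diag SS TT -scalar_mx_block.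
by rewrite !mulmx_block_diag SA TB -scalar_mx_block.
Qed.

Lemma trireflectional_block m n (A : 'M[F]_m) (B : 'M_n) :
  trireflectional A -> trireflectional B -> trireflectional (block_mx A 0 0 B).
Proof.
move=> [S SS SA] [T TT TB]; exists (block_mx S 0 0 T).
  by rewrite mulmx_block_diag SS TT -scalar_mx_block.
by rewrite mulmx_block_diag; apply: bireflectional_block.
Qed.

Lemma bireflectional_opp n (A : 'M[F]_n) :
  bireflectional (- A) -> bireflectional A.
Proof. by case=> T TT TA; exists T => //; rewrite -TA !mulmxN mulNmx opprK. Qed.

Lemma bireflectional_tri n (A : 'M[F]_n) :
  bireflectional A -> trireflectional A.
Proof. by move=> rA; exists 1%:M; rewrite mul1mx. Qed.

Lemma bireflectional_det n (A : 'M[F]_n) :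
  bireflectional A -> \det A = 1 \/ \det A = -1.
Proof.
case=> T /(congr1 determinant) + /(congr1 determinant).
rewrite !det_mulmx det1 mulrACA => ->; rewrite mul1r => /eqP.
by rewrite -expr2 sqrf_eq1 => /orP[] /eqP; [left | right].
Qed.

(** The rows of K lie in the kernel of P, while P remains injective on the span of
    the rows of W: the two spans meet trivially. *)
Lemma row_free_col_mx m1 m2 n p (W : 'M[F]_(m1, n)) (K : 'M_(m2, n))
    (P : 'M_(n, p)) :
  row_free (W *m P) -> K *m P = 0 -> row_free K -> row_free (col_mx W K).
Proof.
move=> freeWP KP freeK; apply: inj_row_free => u.
rewrite -[u]hsubmxK mul_row_col => uWK.
have u1 : lsubmx u = 0.
  apply: (row_free_inj freeWP); move/(congr1 (mulmx^~ P)): uWK.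
  by rewrite mulmxDl -!mulmxA KP mulmx0 addr0 !mul0mx.
have u2 : rsubmx u = 0.
  by apply: (row_free_inj freeK); move: uWK; rewrite u1 !mul0mx add0r.
by rewrite u1 u2 row_mx0.
Qed.

(** When the rows of W and K together form a basis and each of the two spans is
    stable under A, this basis puts A in block diagonal form. *)
Lemma stable_split_conj m1 m2 n (A : 'M[F]_n) (A1 : 'M_m1) (A2 : 'M_m2)
    (W : 'M_(m1, n)) (K : 'M_(m2, n)) :
    row_free (col_mx W K) -> row_full (col_mx W K) ->
    W *m A = A1 *m W -> K *m A = A2 *m K ->
  exists2 Q, col_mx W K *m Q = 1%:M /\ Q *m col_mx W K = 1%:M &
             A = Q *m block_mx A1 0 0 A2 *m col_mx W K.
Proof.
move=> free full WA KA; exists (pinvmx (col_mx W K)).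
  by rewrite mulmxVp ?mulVpmx.
rewrite -mulmxA mul_block_col !mul0mx addr0 add0r -WA -KA -mul_col_mx mulmxA.
by rewrite mulVpmx ?mul1mx.
Qed.

Lemma intertwineX m n (W : 'M[F]_(m, n)) X Y k :
  W *m X = Y *m W -> W *m X ^+ k = Y ^+ k *m W.
Proof.
move=> WX; elim: k => [|k IHk]; first by rewrite !expr0 mulmx1 mul1mx.
rewrite [X ^+ _]exprSr [Y ^+ _]exprS -!mulmxE mulmxA IHk -mulmxA WX.
by rewrite mulmxA -[Y ^+ k *m Y]exprSr exprS.
Qed.

End Involutions.

(** * Operators with a cyclic vector *)

Section CyclicVector.
Variable F : fieldType.

Definition cyclic_vector n (A : 'M[F]_n.+1) (v : 'rV_n.+1) : Prop :=
  forall x : 'rV_n.+1, exists g, x = v *m horner_mx A g.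

Definition krylov_mx n (A : 'M[F]_n.+1) (v : 'rV_n.+1) : 'M_n.+1 :=
  \matrix_(i < n.+1) (v *m A ^+ i).

Lemma mul_vec_horner_mx n (A : 'M[F]_n.+1) v (g : {poly F}) :
    (size g <= n.+1)%N ->
  v *m horner_mx A g = poly_rV g *m krylov_mx A v.
Proof.
move=> sg; rewrite -{1}(poly_rV_K sg) /rVpoly poly_def linear_sum /= mulmx_sumr.
rewrite mulmx_sum_row; apply: eq_bigr => i _.
rewrite linearZ rmorphXn /= horner_mx_X -scalemxAr rowK insubT// => lt.
by rewrite (_ : Sub _ _ = i)//; apply: val_inj.
Qed.

Lemma horner_mx_mod n (A : 'M[F]_n.+1) (p g : {poly F}) :
  horner_mx A p = 0 -> horner_mx A (g %% p) = horner_mx A g.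
Proof.
by move=> pA; rewrite {2}(divp_eq g p) rmorphD rmorphM /= pA mulr0 add0r.
Qed.

(** Reduction modulo p shows that the n + 1 vectors v A^i already span the
    space. *)
Lemma krylov_unitmx n (A : 'M[F]_n.+1) v (p : {poly F}) :
    cyclic_vector A v -> size p = n.+2 -> horner_mx A p = 0 ->
  krylov_mx A v \in unitmx.
Proof.
move=> cyc sp pA; rewrite -row_full_unit -sub1mx; apply/row_subP => i.
have [g ->] := cyc (row i 1%:M).
rewrite -(horner_mx_mod g pA) mul_vec_horner_mx ?submxMl//.
by rewrite -ltnS -sp ltn_modp -size_poly_eq0 sp.
Qed.

(** Identify the space with F[t]/(p), where v is the class of 1 and A is the
    multiplication by t. As p annihilates the inverse of A as well, the substitution
    of 1/t for t is a well-defined linear map; it is an involution, and it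
    conjugates A to its inverse. *)
Lemma cyclic_bireflectional n (A : 'M[F]_n.+1) v (p : {poly F}) :
    cyclic_vector A v -> A \in unitmx -> size p = n.+2 ->
    horner_mx A p = 0 -> horner_mx (invmx A) p = 0 ->
  bireflectional A.
Proof.
move=> cyc uA sp pA pA'; set W := krylov_mx A v.
have uW : W \in unitmx := krylov_unitmx cyc sp pA.
(* T sends v A^i to v A^-i for i <= n; by reduction modulo p, vT extends this
   rule to all polynomials in A. *)
pose T := invmx W *m krylov_mx (invmx A) v.
have vT g : v *m horner_mx A g *m T = v *m horner_mx (invmx A) g.
  rewrite -(horner_mx_mod g pA) -(horner_mx_mod g pA').
  have sg : (size (g %% p)%R <= n.+1)%N.
    by rewrite -ltnS -sp ltn_modp -size_poly_eq0 sp.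
  by rewrite !mul_vec_horner_mx // /T mulmxA mulmxK.
clearbody T.
have eq_cyc (X Y : 'M_n.+1) :
    (forall g, v *m horner_mx A g *m X = v *m horner_mx A g *m Y) -> X = Y.
  move=> XY; apply/row_matrixP => i; rewrite !rowE.
  by have [g ->] := cyc ('e_i); apply: XY.
have AT : A *m T = T *m invmx A.
  apply: eq_cyc => g; have := vT (g * 'X).
  by rewrite !rmorphM /= !horner_mx_X -!mulmxE !mulmxA vT.
have hT g : horner_mx (invmx A) g *m T = T *m horner_mx A g.
  have A'T : invmx A *m T = T *m A.
    have {1}-> : T = A *m (T *m A) by rewrite mulmxA AT mulmxKV.
    by rewrite mulKmx.
  elim/poly_ind: g => [|g c IHg]; first by rewrite !rmorph0 mul0mx mulmx0.
  rewrite !rmorphD !rmorphM /= !horner_mx_X !horner_mx_C mulmxDl mulmxDr.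
  by rewrite -!mulmxE -mulmxA A'T mulmxA IHg mulmxA scalar_mxC.
have vT1 : v *m T = v.
  by have := vT 1; rewrite !rmorph1 !mulmx1.
have TT : T *m T = 1%:M.
  apply: eq_cyc => g.
  by rewrite mulmxA vT -mulmxA hT mulmxA vT1 mulmx1.
exists T => //.
by rewrite -mulmxA (mulmxA A) AT mulmxA -(mulmxA T) mulmxKV // TT.
Qed.

End CyclicVector.

(** * Unipotent matrices and their cyclic summands *)

Section Unipotent.
Variable F : fieldType.

Lemma bireflectional_mx0 (A : 'M[F]_0) : bireflectional A.
Proof. by exists 1%:M; rewrite [LHS]thinmx0 [RHS]thinmx0. Qed.

(** Geometric series: 1 - (1 - A)^k is a multiple of A. *)
Lemma unipotent_unitmx n (A : 'M[F]_n) : nilpotent_mx (A - 1) -> A \in unitmx.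
Proof.
case=> k Zk; have cZ : GRing.comm 1 (1 - A) by apply: commr_sym; apply: commr1.
have Zk' : (1 - A) ^+ k = 0 by rewrite -opprB exprNn Zk mulr0.
have := subrXX_comm k cZ; rewrite Zk' subr0 expr1n subKr -mulmxE => /esym H.
by case: (mulmx1_unit H).
Qed.

Lemma unipotent_inv n (A : 'M[F]_n) k :
  A \in unitmx -> (A - 1) ^+ k = 0 -> (invmx A - 1) ^+ k = 0.
Proof.
move=> uA Zk; have VA : invmx A * A = 1 by apply: mulVmx.
have AV : A * invmx A = 1 by apply: mulmxV.
have -> : invmx A - 1 = (1 - A) * invmx A by rewrite mulrBl mul1r AV.
rewrite exprMn_comm; last by rewrite /GRing.comm mulrBl mulrBr VA AV mul1r mulr1.
by rewrite -opprB exprNn Zk mulr0 mul0r.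
Qed.

Definition shift_mx k : 'M[F]_k := \matrix_(i, j) (i.+1 == j)%:R.

Lemma shift_mxX k m i j : (shift_mx k ^+ m) i j = (i + m == j)%N%:R.
Proof.
elim: m i => [|m IHm] i; first by rewrite expr0 mxE addn0.
rewrite exprS -mulmxE mxE; under eq_bigr => l _ do rewrite IHm mxE.
have [lt|ge] := ltnP i.+1 k.
  rewrite (bigD1 (Ordinal lt)) //= eqxx mul1r big1 ?addr0 ?addnS //.
  by move=> l /negPf; rewrite -val_eqE /= eq_sym => ->; rewrite mul0r.
rewrite big1 => [|l _]; last by rewrite gtn_eqF ?mul0r// (leq_trans _ ge).
rewrite eqn_leq leqNgt (leq_trans (ltn_ord j)) // addnS.
by rewrite (leq_trans ge) ?leq_addr.
Qed.

(** A Jordan block is cyclic, and both it and its inverse are annihilated by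
    (X - 1)^k. *)
Lemma shift_bireflectional k : bireflectional (1 + shift_mx k).
Proof.
case: k => [|k]; first exact: bireflectional_mx0.
set S := shift_mx _; set A := 1 + S.
have Sk : (A - 1) ^+ k.+1 = 0.
  rewrite /A addrC addKr; apply/matrixP => i j; rewrite shift_mxX mxE gtn_eqF //.
  by rewrite (leq_trans (ltn_ord j)) ?leq_addl.
have uA : A \in unitmx by apply: unipotent_unitmx; exists k.+1.
have hp (B : 'M[F]_k.+1) m : horner_mx B (('X - 1%:P) ^+ m) = (B - 1) ^+ m.
  by rewrite rmorphXn rmorphB /= horner_mx_X horner_mx_C.
apply: (@cyclic_bireflectional F k A 'e_0 (('X - 1%:P) ^+ k.+1)) => //.
- move=> x; exists (\sum_i x 0 i *: ('X - 1%:P) ^+ i).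
  rewrite linear_sum mulmx_sumr [LHS]row_sum_delta; apply: eq_bigr => i _.
  rewrite linearZ /= -scalemxAr hp /A addrC addKr -rowE.
  by congr (_ *: _); apply/rowP => j; rewrite [RHS]mxE shift_mxX mxE eqxx eq_sym.
- by rewrite size_exp_XsubC.
- by rewrite hp.
by rewrite hp unipotent_inv.
Qed.

(** One step of the Jordan decomposition. With k.+1 the nilpotency index, choose a
    row vector v and a column vector f with v Z^k f != 0. The span of the v Z^a
    is a Jordan block, and the vectors killed by all Z^b f form a stable
    subspace, of the complementary dimension. They are complementary since the
    Gram matrix of the v Z^a against the Z^(k - b) f is triangular with a
    constant nonzero diagonal. *)
Lemma nilpotent_cyclic_split n (Z : 'M[F]_n.+1) : nilpotent_mx Z ->
  exists k r (W : 'M_(k.+1, n.+1)) (K : 'M_(r, n.+1)) (D : 'M_r),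
    [/\ row_free (col_mx W K), row_full (col_mx W K),
        W *m Z = shift_mx k.+1 *m W, K *m Z = D *m K & nilpotent_mx D].
Proof.
move=> nZ; have /ex_minnP[[|k] /eqP Zk0 kmin]: exists m, Z ^+ m == 0.
- by case: nZ => m /eqP; exists m.
- by move/matrixP/(_ 0 0): Zk0; rewrite expr0 !mxE eqxx => /eqP; rewrite oner_eq0.
have /matrix0Pn[i [j zn0]] : Z ^+ k != 0.
  by apply/negP => /kmin; rewrite ltnn.
set z := _ i j in zn0.
(* Here v is the basis vector e_i divided by z and f is the dual basis vector
   of index j, so that v Z^k f = 1. *)
pose W := \matrix_(a < k.+1, c < n.+1) (z^-1 * (Z ^+ a) i c).
pose P := \matrix_(c < n.+1, b < k.+1) (Z ^+ (k - b)) c j.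
have le_k (a : 'I_k.+1) : (a <= k)%N by rewrite -ltnS.
have Zbig m : (k < m)%N -> Z ^+ m = 0.
  by move=> /subnK <-; rewrite exprD Zk0 mulr0.
have WP a b : (W *m P) a b = z^-1 * (Z ^+ (a + (k - b))) i j.
  rewrite exprD -mulmxE !mxE mulr_sumr; apply: eq_bigr => c _.
  by rewrite !mxE mulrA.
have uG : W *m P \in unitmx.
  rewrite unitmxE -det_tr det_trig.
    rewrite big1 ?unitr1// => a _.
    by rewrite mxE WP subnKC// mulVf.
  apply/is_trig_mxP => a b ab; rewrite mxE WP Zbig ?mxE ?mulr0//.
  by rewrite addnBA// ltn_subRL ltn_add2r.
have WZ : W *m Z = shift_mx k.+1 *m W.
  apply/matrixP => a c.
  have -> : (W *m Z) a c = z^-1 * (Z ^+ a.+1) i c.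
    rewrite exprSr -mulmxE !mxE mulr_sumr; apply: eq_bigr => d _.
    by rewrite !mxE mulrA.
  rewrite mxE; have [lt|ge] := ltnP a.+1 k.+1.
    rewrite (bigD1 (Ordinal lt)) //= !mxE eqxx mul1r big1 ?addr0 // => l.
    by rewrite -val_eqE /= eq_sym mxE => /negPf ->; rewrite mul0r.
  rewrite Zbig// mxE mulr0 big1 // => l _.
  by rewrite mxE gtn_eqF ?mul0r// (leq_trans _ ge).
have ZP : Z *m P = P *m shift_mx k.+1.
  apply/matrixP => c b.
  have -> : (Z *m P) c b = (Z ^+ (k - b).+1) c j.
    by rewrite exprS -mulmxE !mxE; apply: eq_bigr => d _; rewrite !mxE.
  rewrite mxE; case: b => [[|b] ltb] /=.
    by rewrite subn0 Zk0 mxE big1// => l _; rewrite !mxE mulr0.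
  rewrite (bigD1 (Ordinal (ltnW ltb))) //= !mxE eqxx mulr1 big1 ?addr0.
    by rewrite subnSK.
  by move=> l; rewrite -val_eqE /= => /negPf nl; rewrite !mxE /= eqSS nl mulr0.
pose K := row_base (kermx P).
have eqK : (K :=: kermx P)%MS := eq_row_base _.
have freeK : row_free K := row_base_free _.
clearbody K W.
have KP : K *m P = 0 by apply/sub_kermxP; rewrite eqK.
have /submxP[D KZ] : (K *m Z <= K)%MS.
  by rewrite eqK; apply/sub_kermxP; rewrite -mulmxA ZP mulmxA KP mul0mx.
exists k, (\rank (kermx P)), W, K, D; split=> //.
- by apply: (@row_free_col_mx _ _ _ _ _ _ _ P); rewrite ?row_free_unit.
- rewrite -sub1mx -addsmxE; set C := P *m invmx (W *m P) *m W.
  rewrite -[1%:M](addrNK C) addrC addmx_sub_adds ?submxMl// eqK.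
  by apply/sub_kermxP; rewrite mulmxBl mul1mx -!mulmxA mulVmx// mulmx1 subrr.
- case: nZ => m Zm; exists m; apply: (row_free_inj freeK).
  by rewrite mul0mx -(intertwineX _ KZ) Zm mulmx0.
Qed.

End Unipotent.

(** * Splitting off the eigenvalue 1 *)

Section Fitting.
Variable F : fieldType.

(** Induction on the size, removing one Jordan block at a time. *)
Lemma unipotent_bireflectional n (A : 'M[F]_n) :
  nilpotent_mx (A - 1) -> bireflectional A.
Proof.
have [m] := ubnP n; elim: m n A => // m IHm [|n] A.
  by move=> _ _; apply: bireflectional_mx0.
rewrite ltnS => lt_nm nA.
have [k [r [W [K [D [free full WZ KZ nD]]]]]] := nilpotent_cyclic_split nA.
have stable (p : nat) (V : 'M[F]_(p, n.+1)) (B : 'M_p) :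
    V *m (A - 1) = B *m V -> V *m A = (1 + B) *m V.
  by move=> VB; rewrite mulmxDl mul1mx -VB mulmxBr mulmx1 addrC subrK.
have WA := stable _ _ _ WZ; have KA := stable _ _ _ KZ.
have [Q [PQ QP] ->] := stable_split_conj free full WA KA.
apply: bireflectional_conj => //; apply: bireflectional_block.
  exact: shift_bireflectional.
apply: IHm; last by rewrite addrC addKr.
have: (k.+1 + r = n.+1)%N.
  by move: free full; rewrite /row_free /row_full => /eqP -> /eqP.
by move=> e; rewrite (leq_trans _ lt_nm) // -e addSn ltnS leq_addl.
Qed.

(** The characteristic polynomial of Z is g X^k with g(0) != 0. Dividing g(Z) by
    the constant g(0) shows that 1 - Z H is a multiple of g(Z) for some polynomial
    H in Z, so it is annihilated by Z^k. Hence H inverts Z on the image of a power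
    of Z; the exponent k.+1 rather than k guarantees that this power is
    positive. *)
Lemma fitting_inverse n (Z : 'M[F]_n) :
  exists k H, Z *m H = H *m Z /\ Z ^+ k.+1 = Z ^+ k.+1 *m (Z *m H).
Proof.
case: n Z => [|n] Z.
  by exists 0%N, 1%:M; split; rewrite [LHS]thinmx0 [RHS]thinmx0.
have [k [q /implyP q0 Dp]] := multiplicity_XsubC (char_poly Z) 0.
have {q0} : ~~ root q 0 by apply: q0; rewrite monic_neq0 ?char_poly_monic.
have := Cayley_Hamilton Z; rewrite Dp subr0 rmorphM rmorphXn /= horner_mx_X {Dp}.
elim/poly_ind: q => [|h c _]; first by rewrite root0.
rewrite rootE !hornerE => qZ c0; pose H := - c^-1 *: horner_mx Z h.
have cZH : horner_mx Z h * Z = Z * horner_mx Z h.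
  exact/comm_horner_mx.
exists k, H; split; first by rewrite /H -scalemxAr -scalemxAl !mulmxE cZH.
have eqH : 1 - Z * H = c^-1 *: horner_mx Z (h * 'X + c%:P).
  rewrite rmorphD rmorphM /= horner_mx_X horner_mx_C scalerDr /H -scalerAr cZH.
  by rewrite scaleNr opprK addrC scale_scalar_mx mulVf.
have : (1 - Z * H) * Z ^+ k = 0 by rewrite eqH -scalerAl qZ scaler0.
rewrite mulrBl mul1r => /eqP; rewrite subr_eq0 => /eqP ZkH.
have cZk : GRing.comm (Z * H) (Z ^+ k).
  apply: commrX; rewrite /GRing.comm -mulrA; congr (_ * _).
  by rewrite /H -scalerAr -scalerAl cZH.
by rewrite !mulmxE exprS {1}ZkH cZk mulrA.
Qed.

Lemma row_base_stable n (X Z : 'M[F]_n) : X *m Z = Z *m X ->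
  exists D, row_base X *m Z = D *m row_base X.
Proof.
move=> XZ; apply/submxP; rewrite eq_row_base.
have /submxP[C ->] : (row_base X <= X)%MS by rewrite eq_row_base.
by rewrite -mulmxA XZ mulmxA submxMl.
Qed.

(** With Z = A - 1 and H as in [fitting_inverse], E = (Z H)^(k.+1) is an idempotent
    that commutes with A. Its image carries the part where Z is invertible, and the
    image of 1 - E the part where Z is nilpotent. *)
Lemma fitting_split n (A : 'M[F]_n) :
  exists m1 m2 (W : 'M_(m1, n)) (K : 'M_(m2, n)) (A1 : 'M_m1) (A2 : 'M_m2),
    [/\ row_free (col_mx W K), row_full (col_mx W K),
        W *m A = A1 *m W, K *m A = A2 *m K
      & nilpotent_mx (A1 - 1) /\ A2 - 1 \in unitmx].
Proof.
have [Z ->] : exists Z, A = 1 + Z by exists (A - 1); rewrite addrC subrK.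
have [k [H [ZH Zk]]] := fitting_inverse Z.
pose E := (Z * H) ^+ k.+1.
have ZkZH j : Z ^+ k.+1 * (Z * H) ^+ j = Z ^+ k.+1.
  elim: j => [|j IHj]; first by rewrite expr0 mulr1.
  by rewrite [_ ^+ j.+1]exprSr mulrA IHj [RHS]Zk.
have ZkE : Z ^+ k.+1 * E = Z ^+ k.+1 := ZkZH k.+1.
have cZH : GRing.comm (Z * H) Z by rewrite /GRing.comm -mulrA -[H * Z]ZH.
have EZ : E * Z = Z * E by apply/commr_sym/commrX/commr_sym.
have EEk : E * Z ^+ k.+1 = Z ^+ k.+1.
  by rewrite -[RHS]ZkE; apply: commrX.
have EE : E * E = E.
  by rewrite {2}/E exprMn_comm // mulrA EEk -exprMn_comm.
have EH : E * H = H * E.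
  by apply/commr_sym/commrX; rewrite /GRing.comm mulrA -[H * Z]ZH.
pose W := row_base (1 - E); pose K := row_base E.
have freeW : row_free W := row_base_free _.
have freeK : row_free K := row_base_free _.
have eqW : (W :=: 1 - E)%MS := eq_row_base _.
have eqK : (K :=: E)%MS := eq_row_base _.
have [D1 WZ] : exists D, W *m Z = D *m W.
  by apply: row_base_stable; rewrite !mulmxE mulrBl mulrBr EZ mulr1 mul1r.
have [D2 KZ] : exists D, K *m Z = D *m K by apply: row_base_stable.
have [D3 KH] : exists D, K *m H = D *m K by apply: row_base_stable.
clearbody W K.
have KE : K *m E = K.
  have /submxP[C ->] : (K <= E)%MS by rewrite eqK.
  by rewrite -mulmxA [E *m E]EE.
have WE : W *m E = 0.
  have /submxP[C ->] : (W <= 1 - E)%MS by rewrite eqW.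
  by rewrite -mulmxA mulmxE mulrBl mul1r EE subrr mulmx0.
exists _, _, W, K, (1 + D1), (1 + D2); split.
- apply: (@row_free_col_mx _ _ _ _ _ _ _ (1 - E)) => //.
    by rewrite mulmxBr mulmx1 WE subr0.
  by rewrite mulmxBr mulmx1 KE subrr.
- by rewrite -sub1mx -addsmxE -[1%:M](subrK E) addmx_sub_adds ?eqW ?eqK.
- by rewrite mulmxDl mul1mx -WZ mulmxDr mulmx1.
- by rewrite mulmxDl mul1mx -KZ mulmxDr mulmx1.
rewrite (addrC 1 D1) (addrC 1 D2) !addrK; split.
  exists k.+1; apply: (row_free_inj freeW).
  by rewrite mul0mx -(intertwineX _ WZ) -EEk mulmxA WE mul0mx.
have KZH : K *m (Z * H) = (D2 *m D3) *m K.
  by rewrite -mulmxE mulmxA KZ -mulmxA KH mulmxA.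
have DD : (D2 *m D3) ^+ k.+1 = 1%:M.
  by apply: (row_free_inj freeK); rewrite -(intertwineX _ KZH) mul1mx.
move: DD; rewrite exprS -!mulmxE -mulmxA => /mulmx1_unit[] //.
Qed.

(** The hypothesis says that all eigenvalues are 1 or -1. After splitting off the
    unipotent part, N - 1 is invertible, so the nilpotency of (N - 1) (N + 1) passes
    to N + 1, and - N is unipotent. In characteristic 2 the second part is
    empty. *)
Lemma bireflectional_of_sq_unipotent n (N : 'M[F]_n) :
  nilpotent_mx (N *m N - 1) -> bireflectional N.
Proof.
case=> k Nk.
have [m1 [m2 [W [K [N1 [N2 [free full WN KN [nN1 uN2]]]]]]]] := fitting_split N.
have [Q [PQ QP] ->] := stable_split_conj free full WN KN.
apply: bireflectional_conj => //; apply: bireflectional_block.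
  exact: unipotent_bireflectional.
apply: bireflectional_opp; apply: unipotent_bireflectional; exists k.
have freeK : row_free K.
  apply: inj_row_free => u uK; have := row_free_inj free.
  move=> /(_ _ (row_mx 0 u) 0); rewrite mul_row_col !mul0mx add0r => /(_ uK).
  by rewrite -row_mx0 => /eq_row_mx[].
have KNN : K *m (N *m N - 1) = (N2 *m N2 - 1) *m K.
  by rewrite mulmxBr mulmxBl mulmx1 mul1mx mulmxA KN -mulmxA KN mulmxA.
have : (N2 *m N2 - 1) ^+ k = 0.
  by apply: (row_free_inj freeK); rewrite -(intertwineX _ KNN) Nk mulmx0 mul0mx.
have -> : N2 *m N2 - 1 = (N2 - 1) * (N2 + 1) by rewrite -subr_sqr_1.
rewrite exprMn_comm => [NN0|]; last first.
  by rewrite /GRing.comm -subr_sqr_1 mulrDl mulrBr mulr1 mul1r addrA subrK.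
have uN2k : (N2 - 1) ^+ k \in unitmx.
  elim: k {Nk NN0} => [|k IHk]; first by rewrite expr0 unitmx1.
  by rewrite exprS -mulmxE unitmx_mul uN2.
rewrite -opprD exprNn.
have -> : (N2 + 1) ^+ k = 0 by rewrite -[LHS](mulKmx uN2k) [X in _ *m X]NN0 mulmx0.
by rewrite mulr0.
Qed.

End Fitting.

(** * Factoring a nonscalar matrix into triangular factors *)

Section TriangularFactors.
Variable F : fieldType.

Definition lower_mx m n (X : 'M[F]_(n, m)) : 'M_(m + n) := block_mx 1%:M 0 X 1%:M.

Lemma lower_mxK m n (X : 'M[F]_(n, m)) :
  lower_mx (- X) *m lower_mx X = 1%:M /\ lower_mx X *m lower_mx (- X) = 1%:M.
Proof.
rewrite !mulmx_block !(mulmx0, mul0mx, mulmx1, mul1mx, addr0, add0r).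
by rewrite addNr addrN -scalar_mx_block.
Qed.

(** As A - 1 is invertible, A (+) 1 is similar to [A, 0; B, 1] for every B, and the
    involution that swaps the two blocks of rows turns the latter into
    [B, 1; A, 0]. *)
Lemma trireflectional_of_companion n (A B : 'M[F]_n) :
    A - 1%:M \in unitmx -> bireflectional (block_mx B 1%:M A 0) ->
  trireflectional (block_mx A 0 0 (1%:M : 'M_n)).
Proof.
move=> uA1 biN; pose p := B *m invmx (A - 1%:M).
have [TK KT] := lower_mxK p.
have -> : block_mx A 0 0 (1%:M : 'M_n) =
    lower_mx (- p) *m block_mx A 0 B 1%:M *m lower_mx p.
  rewrite !mulmx_block !(mulmx0, mul0mx, mulmx1, mul1mx, addr0, add0r).
  have -> : B = p *m A - p by rewrite -{2}[p]mulmx1 -mulmxBr mulmxKV.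
  by rewrite mulNmx addKr addNr.
apply: trireflectional_conj => //; exists (block_mx 0 1%:M 1%:M 0).
  by rewrite mulmx_block !(mulmx0, mul0mx, mulmx1, addr0, add0r) -scalar_mx_block.
by rewrite mulmx_block !(mulmx0, mul0mx, mulmx1, mul1mx, addr0, add0r).
Qed.

(** A power of the matrix has both diagonal blocks zero, so its square is 0. *)
Lemma nilpotent_ublock m n (A : 'M[F]_m) (B : 'M_(m, n)) (D : 'M_n) :
  nilpotent_mx A -> nilpotent_mx D -> nilpotent_mx (block_mx A B 0 D).
Proof.
move=> [i Ai] [j Dj]; have pow k : exists C,
    block_mx A B 0 D ^+ k = block_mx (A ^+ k) C 0 (D ^+ k).
  elim: k => [|k [C IHk]]; first by exists 0; rewrite !expr0 -scalar_mx_block.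
  exists (A *m C + B *m D ^+ k).
  by rewrite exprS -mulmxE IHk mulmx_block !(mul0mx, mulmx0, addr0, add0r) !exprS.
have [C powC] := pow (i + j)%N; exists (i + j + (i + j))%N.
rewrite exprD powC !exprD Ai Dj mulr0 mul0r -mulmxE mulmx_block.
by rewrite !(mul0mx, mulmx0, addr0) block_mx0.
Qed.

Lemma nilpotent_tr n (A : 'M[F]_n) : nilpotent_mx A^T -> nilpotent_mx A.
Proof.
case=> k Ak; exists k; apply: trmx_inj; rewrite trmx0 -Ak.
elim: k {Ak} => [|k IHk]; first by rewrite !expr0 trmx1.
by rewrite exprS exprSr -!mulmxE trmx_mul IHk.
Qed.

Lemma nilpotent_lblock m n (A : 'M[F]_m) (C : 'M_(n, m)) (D : 'M_n) :
  nilpotent_mx A -> nilpotent_mx D -> nilpotent_mx (block_mx A 0 C D).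
Proof.
have tr p (X : 'M[F]_p) : nilpotent_mx X -> nilpotent_mx X^T.
  by move=> nX; apply: nilpotent_tr; rewrite trmxK.
move=> nA nD; apply: nilpotent_tr; rewrite tr_block_mx trmx0.
by apply: nilpotent_ublock; apply: tr.
Qed.

Lemma nilpotent_conj n (P Q X : 'M[F]_n) :
  P *m Q = 1%:M -> nilpotent_mx X -> nilpotent_mx (Q *m X *m P).
Proof.
move=> PQ [k Xk]; exists k.+1.
suff -> : (Q *m X *m P) ^+ k.+1 = Q *m X ^+ k.+1 *m P.
  by rewrite exprS Xk mulr0 mulmx0 mul0mx.
elim: k {Xk} => [|k IHk]; first by rewrite !expr1.
by rewrite exprS IHk -mulmxE mulmx_conj// [in RHS]exprS.
Qed.

(** The choice B = U - L makes [B, 1; L U, 0] similar to [U, L; 0, - L], whose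
    eigenvalues are those of U and - L. *)
Lemma trireflectional_of_LU n (L U : 'M[F]_n) :
    L *m U - 1%:M \in unitmx -> nilpotent_mx (L - 1%:M) ->
    nilpotent_mx (U *m U - 1%:M) ->
  trireflectional (block_mx (L *m U) 0 0 (1%:M : 'M_n)).
Proof.
move=> uA1 nL nU; have uL : L \in unitmx by apply: unipotent_unitmx.
apply: (@trireflectional_of_companion _ _ (U - L)) => //.
pose G := block_mx 1%:M 0 (- 1%:M) (invmx L).
pose G' := block_mx 1%:M 0 L L.
have GG' : G *m G' = 1%:M.
  rewrite mulmx_block !(mulmx0, mul0mx, mulmx1, mul1mx, addr0, add0r) mulVmx//.
  by rewrite addNr -scalar_mx_block.
have -> : block_mx (U - L) 1%:M (L *m U) 0 = G' *m block_mx U L 0 (- L) *m G.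
  rewrite !mulmx_block !(mulmx0, mul0mx, mulmx1, mul1mx, addr0, add0r).
  by rewrite (mulmxN L L) subrr !mul0mx addr0 mulmxN mulmx1 mulmxV.
apply: bireflectional_conj => //; first exact: mulmx1C.
apply: bireflectional_of_sq_unipotent; rewrite mulmx_block.
rewrite !(mulmx0, mul0mx, addr0, add0r) !mulmxN mulNmx opprK.
rewrite [1]scalar_mx_block opp_block_mx add_block_mx !subr0.
apply: nilpotent_ublock => //.
have [k Lk] := nL; exists k; rewrite (_ : _ - _ = (L - 1) * (L + 1)); last first.
  by rewrite -subr_sqr_1.
rewrite exprMn_comm ?[(L - 1) ^+ k]Lk ?mul0r//.
by rewrite /GRing.comm -subr_sqr_1 mulrDl mulrBr mulr1 mul1r addrA subrK.
Qed.

Definition conjugate n (A B : 'M[F]_n) :=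
  exists P Q : 'M_n, [/\ P *m Q = 1%:M, Q *m P = 1%:M & A = Q *m B *m P].

Lemma conjugate_trans n (A B C : 'M[F]_n) :
  conjugate A B -> conjugate B C -> conjugate A C.
Proof.
move=> [P [Q [PQ QP ->]]] [P' [Q' [PQ' QP' ->]]]; exists (P' *m P), (Q *m Q').
by rewrite !mulmxA -(mulmxA P') PQ mulmx1 PQ' -(mulmxA Q) QP' mulmx1 QP.
Qed.

Lemma conjugate_lower n (s : 'cV[F]_n) (A : 'M_(1 + n)) :
  conjugate A (lower_mx s *m A *m lower_mx (- s)).
Proof.
have [sK Ks] := lower_mxK s; exists (lower_mx s), (lower_mx (- s)); split=> //.
by rewrite !mulmxA sK mul1mx -mulmxA sK mulmx1.
Qed.

(** A transposition of basis vectors moves the nonzero entry to the first row. *)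
Lemma offdiag_conjugate n (A : 'M[F]_(1 + n)) i j :
  i != j -> A i j != 0 -> exists2 B, conjugate A B & ursubmx B != 0.
Proof.
move=> ij Aij; pose s := tperm (lshift n (0 : 'I_1)) i.
have ss : perm_mx s *m perm_mx s = 1%:M :> 'M[F]_(1 + n).
  by rewrite -perm_mxM tperm2 perm_mx1.
exists (perm_mx s *m A *m perm_mx s).
  exists (perm_mx s), (perm_mx s).
  by split=> //; rewrite !mulmxA ss mul1mx -mulmxA ss mulmx1.
have -> : perm_mx s *m A *m perm_mx s = row_perm s (col_perm s A).
  by rewrite row_permE col_permE tpermV mulmxA.
have : s j != lshift n 0.
  by rewrite -(inj_eq (@perm_inj _ s)) tpermK tpermL eq_sym.
case: (split_ordP (s j)) => k sj; first by rewrite sj ord1 eqxx.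
move=> _; apply/matrix0Pn; exists 0, k.
by rewrite !mxE -sj tpermK tpermL.
Qed.

(** Some basis vector or sum of two basis vectors is not an eigenvector; it can be
    taken as the first vector of a basis. If A is diagonal with distinct entries at
    0 and i, this is the conjugation by 1 + E, which creates an entry off the
    diagonal. *)
Lemma nonscalar_conjugate n (A : 'M[F]_(1 + n)) :
  ~~ is_scalar_mx A -> exists2 B, conjugate A B & ursubmx B != 0.
Proof.
move=> nscal.
have [/existsP[i /existsP[j /andP[ij Aij]]]|] :=
    boolP [exists i, exists j, (i != j) && (A i j != 0)].
  exact: offdiag_conjugate ij Aij.
rewrite negb_exists => /forallP diagA.
have A0 i j : i != j -> A i j = 0.
  move=> ij; have := diagA i; rewrite negb_exists => /forallP/(_ j).
  by rewrite ij /= negbK => /eqP.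
have [i Ai] : exists i, A i i != A 0 0.
  apply/existsP; apply: contraR nscal; rewrite negb_exists => /forallP Aii.
  apply/is_scalar_mxP; exists (A 0 0); apply/matrixP => i j; rewrite mxE.
  have [<-|/A0 //] := eqVneq i j.
  by apply/eqP/negPn/Aii.
have i0 : i != 0 by apply: contraNneq Ai => ->.
pose E : 'M[F]_(1 + n) := delta_mx i 0.
have EE : E *m E = 0 by rewrite mul_delta_mx_0// eq_sym.
have E1 : (1%:M + E) *m (1%:M - E) = 1%:M.
  by rewrite mulmxDl mulmxBr !mul1mx mulmxBr mulmx1 EE subr0 subrK.
have E2 := mulmx1C E1.
have [] := @offdiag_conjugate n ((1%:M + E) *m A *m (1%:M - E)) i 0 => //.
  have EX (X : 'M[F]_(1 + n)) b : (E *m X) i b = X 0 b.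
    rewrite mxE (bigD1 0) //= mxE !eqxx mul1r big1 ?addr0// => k /negPf k0.
    by rewrite mxE k0 andbF mul0r.
  have XE (X : 'M[F]_(1 + n)) a : (X *m E) a 0 = X a i.
    rewrite mxE (bigD1 i) //= mxE !eqxx mulr1 big1 ?addr0// => k /negPf ki.
    by rewrite mxE ki mulr0.
  rewrite mulmxBr mulmx1 mulmxDl mul1mx mxE [X in X + _]mxE [X in _ + X]mxE.
  rewrite XE [X in _ - X]mxE !EX (A0 i 0)// (A0 0 i) 1?eq_sym//.
  by rewrite add0r addr0 eq_sym subr_eq0 eq_sym.
move=> B cB rB; exists B => //; apply: conjugate_trans cB.
exists (1%:M + E), (1%:M - E).
by split=> //; rewrite !mulmxA E2 mul1mx -mulmxA E2 mulmx1.
Qed.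

(** Adding multiples s of the first basis vector to the others replaces the pivot a
    by a - r s, which can be any scalar because r != 0. *)
Lemma pivot_conjugate n (A : 'M[F]_(1 + n)) : ~~ is_scalar_mx A ->
  exists r c D, conjugate A (block_mx 1%:M r c D) /\ r != 0.
Proof.
move=> /nonscalar_conjugate[B AB rB0]; rewrite -[B]submxK in AB.
move: (ulsubmx B) (ursubmx B) (dlsubmx B) (drsubmx B) AB rB0 => a r c D AB r0.
have /matrix0Pn[i0 [j rj]] := r0; rewrite ord1 in rj.
pose s : 'cV[F]_n := ((a 0 0 - 1) / r 0 j) *: delta_mx j 0.
have rs : r *m s = a - 1%:M.
  rewrite -scalemxAr -colE; apply/matrixP => x y.
  by rewrite !ord1 !mxE eqxx mulfVK.
exists r, (s *m a + c - (s *m r + D) *m s), (s *m r + D); split=> //.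
have := conjugate_trans AB (conjugate_lower s _).
rewrite !mulmx_block !(mulmx0, mul0mx, mulmx1, mul1mx, addr0, add0r).
by rewrite !mulmxN rs subKr.
Qed.

(** Gaussian elimination with pivot 1. *)
Lemma schur_block n (r : 'rV[F]_n) c D :
  block_mx 1%:M r c D = lower_mx c *m block_mx 1%:M r 0 (D - c *m r) :> 'M_(1 + n).
Proof.
rewrite mulmx_block !(mulmx0, mul0mx, mulmx1, mul1mx, addr0, add0r).
by rewrite addrC subrK.
Qed.

Lemma det_schur_block n (r : 'rV[F]_n) c D :
  \det (block_mx 1%:M r c D : 'M_(1 + n)) = \det (D - c *m r).
Proof. by rewrite schur_block det_mulmx det_lblock det_ublock !det1 !mul1r. Qed.

(** The Schur complement of the pivot must be nonscalar for the elimination to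
    continue. If it is the scalar a, replace the basis as in [pivot_conjugate] with
    some s != 0 such that r s = 0: the pivot remains 1 and the Schur complement
    becomes a + a (s r). Since s r is a nonzero matrix with square zero, this is not
    scalar. The scalar a is nonzero because A is invertible. *)
Lemma nonscalar_pivot n (A : 'M[F]_(1 + n.+1)) :
    A \in unitmx -> ~~ is_scalar_mx A ->
  exists r c D, conjugate A (block_mx 1%:M r c D) /\
    (n = 0 \/ ~~ is_scalar_mx (D - c *m r)).
Proof.
move=> uA /pivot_conjugate[r [c [D [AB r0]]]].
case: n => [|n] in A uA r c D AB r0 *; first by exists r, c, D; split=> //; left.
have [/is_scalar_mxP[a Da]|] := boolP (is_scalar_mx (D - c *m r)); last first.
  by exists r, c, D; split=> //; right.
have a0 : a != 0.
  have [P [Q [PQ QP eA]]] := AB; move: uA; rewrite eA !unitmx_mul !unitmxE.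
  rewrite det_schur_block Da det_scalar unitrX_pos// !unitfE.
  by case/andP=> /andP[].
have [s rs s0] : exists2 s : 'cV_n.+2, r *m s = 0 & s != 0.
  have : kermx r^T != 0.
    rewrite -mxrank_eq0 mxrank_ker -lt0n subn_gt0.
    by rewrite (leq_ltn_trans (rank_leq_col _)).
  case/rowV0Pn => v /sub_kermxP vr v0; exists v^T.
    by apply: trmx_inj; rewrite trmx_mul trmxK vr trmx0.
  by apply: contra v0 => /eqP/(congr1 trmx); rewrite trmxK trmx0 => ->.
exists r, (s + c - (s *m r + D) *m s), (s *m r + D); split.
  have := conjugate_trans AB (conjugate_lower s _).
  rewrite !mulmx_block !(mulmx0, mul0mx, mulmx1, mul1mx, addr0, add0r).
  by rewrite !mulmxN rs subr0.
right; have Ds : D *m s = a *: s.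
  rewrite -[D](subrK (c *m r)) Da mulmxDl -[c *m r *m s]mulmxA rs mulmx0 addr0.
  by rewrite mul_scalar_mx.
have -> : s *m r + D - (s + c - (s *m r + D) *m s) *m r = a%:M + a *: (s *m r).
  rewrite [(s *m r + D) *m s]mulmxDl -[s *m r *m s]mulmxA rs mulmx0 add0r Ds.
  rewrite mulmxBl mulmxDl -Da -scalemxAl opprB addrCA [s *m r + D]addrC.
  by rewrite addrKA addrC.
apply/negP => /is_scalar_mxP[b Db].
have {}Db : a *: (s *m r) = (b - a)%:M by rewrite raddfB /= -Db addrC addKr.
have ba : b - a = 0.
  have := congr1 (mulmx r) Db; rewrite -scalemxAr mulmxA rs mul0mx scaler0.
  rewrite mul_mx_scalar => /esym/eqP; rewrite scaler_eq0 (negPf r0) orbF.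
  by move/eqP.
move: Db; rewrite ba raddf0 => /eqP; rewrite scaler_eq0 (negPf a0) /=.
have /matrix0Pn[i [i0 si]] := s0; have /matrix0Pn[j0 [j rj]] := r0.
move=> /eqP/matrixP/(_ i j)/eqP; rewrite !mxE big_ord1.
by rewrite ord1 in si; rewrite ord1 in rj; rewrite mulf_eq0 (negPf si) (negPf rj).
Qed.

Lemma nilpotent0 n : nilpotent_mx (0 : 'M[F]_n).
Proof. by exists 1%N; rewrite expr1. Qed.

(** Elimination with all pivots but the last equal to 1; the last pivot is det A.
    The factors are recorded up to a common similarity, through their
    eigenvalues: 1 for L, and 1 or -1 for U. *)
Lemma nonscalar_LU n (A : 'M[F]_n.+1) :
    A \in unitmx -> \det A = 1 \/ \det A = -1 -> n = 0 \/ ~~ is_scalar_mx A ->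
  exists L U, [/\ A = L *m U, nilpotent_mx (L - 1%:M)
                & nilpotent_mx (U *m U - 1%:M)].
Proof.
elim: n => [|n IHn] in A *; move=> uA dA scalA.
  exists 1%:M, A; split; first by rewrite mul1mx.
    by rewrite subrr; apply: nilpotent0.
  have -> : A = (\det A)%:M by rewrite det_mx11 -mx11_scalar.
  by case: dA => ->; rewrite -scalar_mxM ?mulrNN mulr1 subrr; apply: nilpotent0.
case: scalA => // /(nonscalar_pivot uA)[r [c [D [[P [Q [PQ QP eA]]] scalD]]]].
have detB : \det A = \det (D - c *m r).
  rewrite eA !det_mulmx det_schur_block mulrC mulrA -det_mulmx PQ det1 mul1r//.
have [] := IHn (D - c *m r) _ _ scalD; rewrite -?detB //.
  by rewrite unitmxE -detB -unitmxE.
move=> L [U [DLU nL nU]].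
pose L1 : 'M_(1 + n.+1) := block_mx 1%:M 0 c L.
pose U1 : 'M_(1 + n.+1) := block_mx 1%:M r 0 U.
have conjB1 X : Q *m X *m P - 1%:M = Q *m (X - 1%:M) *m P.
  by rewrite mulmxBr mulmxBl mulmx1 QP.
exists (Q *m L1 *m P), (Q *m U1 *m P); split.
- rewrite mulmx_conj// eA mulmx_block.
  rewrite !(mulmx0, mul0mx, mulmx1, mul1mx, addr0, add0r).
  by rewrite -DLU addrC subrK.
- rewrite conjB1; apply: nilpotent_conj => //.
  rewrite (@scalar_mx_block _ 1 n.+1 1) opp_block_mx add_block_mx subrr !subr0.
  by apply: (@nilpotent_lblock 1 n.+1) => //; apply: nilpotent0.
rewrite mulmx_conj// conjB1.
apply: nilpotent_conj => //; rewrite mulmx_block.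
rewrite !(mulmx0, mul0mx, mulmx1, mul1mx, addr0, add0r).
rewrite (@scalar_mx_block _ 1 n.+1 1) opp_block_mx add_block_mx subrr !subr0.
by apply: (@nilpotent_ublock 1 n.+1) => //; apply: nilpotent0.
Qed.

End TriangularFactors.

(** * The scalar case *)

Section ScalarCase.
Variable F : fieldType.

(** These are the Dickson polynomials with parameter mu, of degree k.+1, which
    express X^(k.+1) + Y^(k.+1) through X + Y when X Y = mu. *)
Definition dickson_like (mu : F) k (D : {poly F}) :=
  [/\ D \is monic, size D = k.+2 & forall n (X Y : 'M[F]_n.+1),
      X * Y = mu%:M -> Y * X = mu%:M ->
      horner_mx (X + Y) D = X ^+ k.+1 + Y ^+ k.+1].

(** The recurrence D_(k+2) = X D_(k+1) - mu D_k. It is started at the degrees 1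
    and 2, since the polynomial 2 of degree 0 is not monic. *)
Lemma dickson_exists mu k : exists D, dickson_like mu k D.
Proof.
suff [D [D' [D1 D2]]] : exists D D', dickson_like mu k D /\ dickson_like mu k.+1 D'.
  by exists D.
elim: k => [|k [D [D' [HD [mD' sD' hD']]]]].
  exists 'X, ('X^2 - (mu *+ 2)%:P); split; split.
  - exact: monicX.
  - by rewrite size_polyX.
  - by move=> n X Y _ _; rewrite horner_mx_X !expr1.
  - exact: monicXnsubC.
  - exact: size_XnsubC.
  move=> n X Y XY YX; rewrite rmorphB rmorphXn /= horner_mx_X horner_mx_C.
  rewrite expr2 mulrDl !mulrDr XY YX -!expr2 raddfMn /= mulr2n.
  by rewrite [mu%:M + _]addrC addrACA addrK.
exists D', (D' * 'X - mu *: D); split=> //.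
have [mD sD hD] := HD.
have slt : (size (- (mu *: D)) < size (D' * 'X)%R)%N.
  rewrite size_polyN size_mulX ?monic_neq0// sD'.
  by rewrite (leq_ltn_trans (size_scale_leq _ _)) // sD.
split.
- by rewrite monicE lead_coefDl// lead_coefMX -monicE.
- by rewrite size_polyDl// size_mulX ?monic_neq0// sD'.
move=> n X Y XY YX; rewrite rmorphB rmorphM /= horner_mxZ horner_mx_X.
have cancelP (P Q : 'M[F]_n.+1) : P * Q = mu%:M ->
    P ^+ k.+2 * Q = mu *: P ^+ k.+1.
  by move=> PQ; rewrite exprSr -mulrA PQ -mulmxE mul_mx_scalar.
rewrite hD' // hD // mulrDr !mulrDl -!exprSr (cancelP X Y) // (cancelP Y X) //.
rewrite scalerDr; move: (mu *: X ^+ _) (mu *: Y ^+ _) => a b.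
by rewrite [a + _]addrC addrACA [b + a]addrC addrK.
Qed.

(** The companion matrix of p has size (size p).-1, which is m.+1 only up to a
    proof; an existential statement absorbs the transport. Its cyclic vector is the
    first basis vector, which it shifts along the basis. *)
Lemma companion_exists m (p : {poly F}) : p \is monic -> size p = m.+2 ->
  exists (B : 'M[F]_m.+1) u, cyclic_vector B u /\ horner_mx B p = 0.
Proof.
move=> mp sp; have [B [charB entB]] : exists B : 'M[F]_m.+1, char_poly B = p /\
    forall i j : 'I_m.+1, (i.+1 < m.+1)%N -> B i j = (i.+1 == j)%:R.
  have e : (size p).-1 = m.+1 by rewrite sp.
  rewrite -e; exists (companionmx p); split; first exact: companionmxK.
  move=> i j lt; rewrite mxE ifN //.
  by apply: contraTneq lt => ->; rewrite prednK ?ltnn // e.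
have eB i (lti : (i < m.+1)%N) : 'e_0 *m B ^+ i = 'e_(Ordinal lti) :> 'rV_m.+1.
  elim: i lti => [|i IHi] lti.
    by rewrite expr0 mulmx1; congr delta_mx; apply: val_inj.
  rewrite exprSr -mulmxE mulmxA (IHi (ltnW lti)) -rowE.
  by apply/rowP => j; rewrite !mxE entB //= [j == _]eq_sym.
exists B, 'e_0; split; last by rewrite -charB Cayley_Hamilton.
move=> x; exists (\sum_i x 0 i *: 'X^i).
rewrite linear_sum mulmx_sumr [LHS]row_sum_delta; apply: eq_bigr => i _.
rewrite linearZ rmorphXn /= horner_mx_X -scalemxAr (eB i (ltn_ord i)).
by congr (_ *: delta_mx _ _); apply: val_inj.
Qed.

Lemma horner_mx_block_diag m (B : 'M[F]_m.+1) (p : {poly F}) :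
  horner_mx (block_mx B 0 0 B : 'M_(m.+1 + m.+1)) p =
    block_mx (horner_mx B p) 0 0 (horner_mx B p).
Proof.
elim/poly_ind: p => [|p c IHp]; first by rewrite !rmorph0 block_mx0.
rewrite !rmorphD !rmorphM /= !horner_mx_X !horner_mx_C IHp -!mulmxE.
rewrite (@scalar_mx_block _ m.+1 m.+1).
rewrite [X in X + _](mulmx_block_diag (horner_mx B p) B (horner_mx B p) B).
have addB (P Q : 'M[F]_m.+1) : block_mx P 0 0 P + block_mx Q 0 0 Q =
    block_mx (P + Q) 0 0 (P + Q).
  by rewrite add_block_mx !addr0.
exact: addB.
Qed.

(** The matrix N = [B, 1; lam, 0] satisfies N + mu N^-1 = B (+) B for mu = - lam.
    Choosing for B a companion matrix of D - (1 + eps), with D the Dickson polynomial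
    of degree M and eps = mu^M, gives N^M + eps N^-M = 1 + eps, that is,
    (N^M - 1) (N^M - eps) = 0. As eps is 1 or -1, the inverse of N satisfies the same
    equation, whose degree 2M is the size of N. So [cyclic_bireflectional] applies
    once N has a cyclic vector, which is inherited from B. *)
Lemma scalar_companion_bireflectional m (lam : F) : lam != 0 ->
    (lam ^+ m.+1 = 1 \/ lam ^+ m.+1 = -1) ->
  exists B : 'M[F]_m.+1, bireflectional (block_mx B 1%:M lam%:M 0).
Proof.
move=> lam0 lam1; set M := m.+1; pose mu := - lam; pose eps := mu ^+ M.
have eps2 : eps * eps = 1.
  rewrite -exprMn mulrNN exprMn.
  by case: lam1 => ->; rewrite ?mulrNN mulr1.
have [D [mD sD hD]] := dickson_exists mu m.
pose p := D - (1 + eps)%:P.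
have sp : size p = m.+2.
  by rewrite size_polyDl// sD size_polyN (leq_ltn_trans (size_polyC_leq1 _)).
have mp : p \is monic.
  rewrite monicE lead_coefDl -?monicE//.
  by rewrite sD size_polyN (leq_ltn_trans (size_polyC_leq1 _)).
have [B [u [cycB pB]]] := companion_exists mp sp.
have DB : horner_mx B D = (1 + eps)%:M.
  by apply/eqP; rewrite -subr_eq0 -pB rmorphB /= horner_mx_C.
exists B; set N : 'M_(M + M) := block_mx _ _ _ _.
(* Y is mu N^-1. *)
pose Y : 'M_(M + M) := block_mx 0 (- 1%:M) (- lam%:M) B.
have NY : N *m Y = mu%:M.
  rewrite mulmx_block !(mulmx0, mul0mx, mulmx1, mul1mx, addr0, add0r).
  rewrite !mulmxN !mulmx1 addNr (@scalar_mx_block _ M M) /mu !raddfN /=.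
  by congr block_mx.
have YN : Y *m N = mu%:M.
  rewrite mulmx_block !(mulmx0, mul0mx, mulmx1, mul1mx, addr0, add0r).
  rewrite !mulNmx !mul1mx scalar_mxC addNr (@scalar_mx_block _ M M) /mu !raddfN /=.
  by congr block_mx.
have NplusY : N + Y = block_mx B 0 0 B.
  by rewrite add_block_mx addr0 addrN addrN add0r.
have mu0 : mu != 0 by rewrite oppr_eq0.
have uN : N \in unitmx.
  have : (mu%:M : 'M[F]_(M + M)) \in unitmx.
    by rewrite unitmxE det_scalar unitrX ?unitfE.
  by rewrite -NY unitmx_mul => /andP[].
have Nlow (z : 'rV_m.+1) : row_mx 0 z *m N = row_mx (lam *: z) 0.
  by rewrite mul_row_block !(mul0mx, mulmx0, add0r) mul_mx_scalar.
clearbody N Y.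
set T := N ^+ M.
have TT : T * T = (1 + eps) *: T - eps%:M.
  have : T + Y ^+ M = (1 + eps)%:M.
    rewrite -hD // NplusY horner_mx_block_diag DB.
    by rewrite -(@scalar_mx_block _ M M).
  move=> TY; have TYM : T * Y ^+ M = eps%:M.
    rewrite -exprMn_comm; last by rewrite /GRing.comm -!mulmxE NY YN.
    by rewrite -mulmxE NY -rmorphXn.
  by rewrite -TYM -mul_mx_scalar -TY mulmxDr addrK.
pose q : {poly F} := ('X^M - 1%:P) * ('X^M - eps%:P).
have hq (X : 'M_(M + M)) :
    horner_mx X q = X ^+ M * X ^+ M - (1 + eps) *: X ^+ M + eps%:M.
  rewrite rmorphM !rmorphB rmorphXn /= !horner_mx_X !horner_mx_C.
  rewrite -!mulmxE mulmxBl !mulmxBr !mul1mx mul_mx_scalar.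
  rewrite opprB [eps%:M - _]addrC addrA -[_ - _ - _]addrA -opprD.
  by rewrite [eps *: _ + _]addrC scalerDl scale1r.
have qN : horner_mx N q = 0 by rewrite hq -/T TT addrAC subrK subrr.
(* The equation for T = N^M, divided by N, expresses Y as a polynomial in N, so
   that the vectors reached from w by polynomials in N are stable under N + Y. *)
pose h : {poly F} := (mu * eps) *: ((1 + eps) *: 'X^m - 'X^(m + M)).
have Yh : Y = horner_mx N h.
  have NYh : N *m Y = N *m horner_mx N h.
    rewrite NY horner_mxZ rmorphB /= horner_mxZ !rmorphXn /= !horner_mx_X.
    rewrite -scalemxAr mulmxBr -scalemxAr !mulmxE exprD mulrA -!exprS TT.
    by rewrite subKr scale_scalar_mx -mulrA eps2 mulr1.
  by rewrite -(mulKmx uN Y) NYh mulKmx.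
pose w := row_mx 0 u : 'rV[F]_(m.+1 + m.+1).
pose reach (x : 'rV[F]_(m.+1 + m.+1)) :=
  exists g, x = w *m (horner_mx N g : 'M_(m.+1 + m.+1)).
have reachD x y : reach x -> reach y -> reach (x + y).
  by move=> [g ->] [g' ->]; exists (g + g'); rewrite rmorphD mulmxDr.
have reachM x g : reach x -> reach (x *m (horner_mx N g : 'M_(m.+1 + m.+1))).
  by move=> [g' ->]; exists (g' * g); rewrite rmorphM -mulmxE mulmxA.
(* N + Y acts on the second block as B, for which u is cyclic. *)
have reach0 y : reach (row_mx 0 y : 'rV[F]_(m.+1 + m.+1)).
  have [g ->] := cycB y.
  have -> : row_mx 0 (u *m horner_mx B g) =
      w *m (horner_mx (N + Y) g : 'M_(m.+1 + m.+1)).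
    rewrite NplusY horner_mx_block_diag mul_row_block.
    by rewrite !(mulmx0, mul0mx, addr0, add0r).
  elim/poly_ind: g => [|g c IHg].
    by exists 0; rewrite !rmorph0.
  rewrite rmorphD rmorphM /= horner_mx_X horner_mx_C mulmxDr -mulmxE mulmxA.
  apply: reachD; last by exists c%:P; rewrite horner_mx_C.
  by have := reachM _ ('X + h) IHg; rewrite rmorphD /= horner_mx_X -Yh.
(* N maps the second block onto the first one. *)
have cyc (x : 'rV_(m.+1 + m.+1)) : reach x.
  rewrite -[x]hsubmxK -[lsubmx x]addr0 -[rsubmx x]add0r -add_row_mx.
  apply: reachD => //.
  have := reachM _ 'X (reach0 (lam^-1 *: lsubmx x)).
  by rewrite horner_mx_X Nlow scalerA mulfV// scale1r.
have VN : invmx N * N = 1 := mulVmx uN.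
apply: (cyclic_bireflectional cyc uN _ qN).
  rewrite size_mul ?monic_neq0 ?monicXnsubC // !size_XnsubC //.
  have -> : ((M.+1 + M.+1).-1 = (M + M).+1)%N by rewrite addSn /= addnS.
  by [].
rewrite hq; set V := invmx N ^+ M.
have VT : V * T = 1.
  rewrite -exprMn_comm ?VN ?expr1n // /GRing.comm VN; exact/esym/mulmxV.
(* The equation of T, multiplied by the square of V = T^-1, is the equation of V
   up to the factor eps. *)
have VTT : V *m (T * T) = (1 + eps) *: 1%:M - eps *: V.
  by rewrite TT mulmxBr -scalemxAr [V *m T]VT mul_mx_scalar.
have VVTT : V *m (V *m (T * T)) = 1%:M.
  by rewrite [V *m (T * T)]mulrA VT mul1r [LHS]VT.
rewrite VTT mulmxBr -!scalemxAr mulmx1 in VVTT.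
rewrite -[eps%:M]scalemx1 -VVTT scalerBr !scalerA eps2 scale1r mulrDr mulr1 eps2.
by rewrite [eps + 1]addrC addrA subrK subrr.
Qed.

End ScalarCase.

(** * Assembling the summands *)

Section Assembly.
Variable F : fieldType.

Lemma trireflectional_no_eigenvalue1 n (A : 'M[F]_n) :
    A - 1%:M \in unitmx -> \det A = 1 \/ \det A = -1 ->
  trireflectional (block_mx A 0 0 (1%:M : 'M_n)).
Proof.
case: n A => [|n] A uA1 detA.
  exact/bireflectional_tri/bireflectional_mx0.
have uA : A \in unitmx.
  by rewrite unitmxE; case: detA => ->; rewrite ?unitrN unitr1.
have [/is_scalar_mxP[lam eA]|nscalA] := boolP (is_scalar_mx A).
  have lam0 : lam != 0.
    by move: uA; rewrite eA unitmxE det_scalar unitrX_pos // unitfE.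
  rewrite eA det_scalar in detA.
  have [B biB] := scalar_companion_bireflectional lam0 detA.
  by apply: trireflectional_of_companion uA1 _; rewrite eA; exact: biB.
have [L [U [eA nL nU]]] := nonscalar_LU uA detA (or_intror nscalA).
by rewrite eA in uA1 *; apply: trireflectional_of_LU.
Qed.

(** Exchanging the two middle summands of A (+) B (+) 1 (+) 1. *)
Lemma trireflectional_regroup m1 m2 (A : 'M[F]_m1) (B : 'M_m2) :
    trireflectional (block_mx A 0 0 (1%:M : 'M_m1)) ->
    trireflectional (block_mx B 0 0 (1%:M : 'M_m2)) ->
  trireflectional (block_mx (block_mx A 0 0 B) 0 0 (1%:M : 'M_(m1 + m2))).
Proof.
move=> triA triB.
pose P : 'M[F]_((m1 + m1) + (m2 + m2), (m1 + m2) + (m1 + m2)) :=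
  block_mx (block_mx 1%:M 0 0 0) (block_mx 0 0 1%:M 0)
           (block_mx 0 1%:M 0 0) (block_mx 0 0 0 1%:M).
pose Q : 'M[F]_((m1 + m2) + (m1 + m2), (m1 + m1) + (m2 + m2)) :=
  block_mx (block_mx 1%:M 0 0 0) (block_mx 0 0 1%:M 0)
           (block_mx 0 1%:M 0 0) (block_mx 0 0 0 1%:M).
pose simp := (mulmx_block, mulmx0, mul0mx, mulmx1, mul1mx, add_block_mx,
              addr0, add0r).
have PQ : P *m Q = 1%:M.
  rewrite !simp (@scalar_mx_block _ (m1 + m1)) !(@scalar_mx_block _ _ _ 1).
  by rewrite !block_mx0.
have QP : Q *m P = 1%:M.
  rewrite !simp (@scalar_mx_block _ (m1 + m2)) !(@scalar_mx_block _ _ _ 1).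
  by rewrite !block_mx0.
have -> : block_mx (block_mx A 0 0 B) 0 0 (1%:M : 'M_(m1 + m2)) =
    Q *m block_mx (block_mx A 0 0 (1%:M : 'M_m1)) 0 0
                  (block_mx B 0 0 (1%:M : 'M_m2)) *m P.
  by rewrite !simp !block_mx0 -scalar_mx_block.
by apply: trireflectional_conj => //; apply: trireflectional_block.
Qed.

(** The unipotent part of A has determinant 1 or -1, being a product of two
    involutions; hence so has the other part. *)
Lemma trireflectional_stable n (A : 'M[F]_n) : \det A = 1 \/ \det A = -1 ->
  trireflectional (block_mx A 0 0 (1%:M : 'M_n)).
Proof.
move=> detA.
have [m1 [m2 [W [K [A1 [A2 [free full WA KA [nA1 uA2]]]]]]]] := fitting_split A.
have [Q [PQ QP] eA] := stable_split_conj free full WA KA.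
have biA1 := unipotent_bireflectional nA1.
have mn : (m1 + m2 = n)%N.
  by move: free full; rewrite /row_free /row_full => /eqP -> /eqP.
have detA2 : \det A2 = 1 \/ \det A2 = -1.
  have : \det A = \det A1 * \det A2.
    rewrite -(det_lblock _ 0) eA; move: (col_mx W K) Q PQ {eA QP free full} => P Q.
    move: P Q; rewrite -mn => P Q PQ.
    by rewrite !det_mulmx mulrC mulrA -det_mulmx PQ det1 mul1r.
  have [->|->] := bireflectional_det biA1; first by rewrite mul1r => <-.
  rewrite mulN1r => detAN.
  have -> : \det A2 = - \det A by rewrite detAN opprK.
  by case: detA => ->; [right | left; rewrite opprK].
have triA1 : trireflectional (block_mx A1 0 0 (1%:M : 'M_m1)).
  apply: bireflectional_tri; apply: bireflectional_block => //.
  by exists 1%:M; rewrite !mulmx1.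
have := trireflectional_regroup triA1 (trireflectional_no_eigenvalue1 uA2 detA2).
set P := col_mx W K in PQ QP eA *.
pose P2 := block_mx P 0 0 P; pose Q2 := block_mx Q 0 0 Q.
have PQ2 : P2 *m Q2 = 1%:M.
  by rewrite mulmx_block !(mulmx0, mul0mx, addr0, add0r) PQ -scalar_mx_block.
have QP2 : Q2 *m P2 = 1%:M.
  by rewrite mulmx_block !(mulmx0, mul0mx, addr0, add0r) QP -scalar_mx_block.
move/(trireflectional_conj PQ2 QP2).
by rewrite !mulmx_block !(mulmx0, mul0mx, mulmx1, addr0, add0r) -eA QP.
Qed.

Lemma mx_involutionP n (S : 'M[F]_n) : S *m S = 1%:M -> mx_involution S.
Proof. by move=> SS; split=> //; case: (mulmx1_unit SS). Qed.

End Assembly.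

Theorem theorem1p7 (F : fieldType) (n : nat) (hn : (1 <= n)%N)
    (A : 'M[F]_n) (hA : A \in unitmx) (hdet : \det A = 1 \/ \det A = -1) :
  exists S1 S2 S3 : 'M[F]_(n + n),
    [/\ mx_involution S1, mx_involution S2, mx_involution S3
      & block_mx A 0 0 1%:M = S1 *m S2 *m S3].
Proof.
have [S SS [T TT TM]] := trireflectional_stable hdet.
exists S, T, (T *m (S *m block_mx A 0 0 1%:M)); split; try exact: mx_involutionP.
by rewrite -mulmxA (mulmxA T) TT mul1mx mulmxA SS mul1mx.
Qed.
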